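(* Let $A$ be a finite dimensional weak $C^*$-Hopf algebra with dual $\hat A$, let $M$ be an $A$-module algebra and let $M_R=A\triangleright1_M$. Then $M_R\subset M$ is a unital $*$-subalgebra, and the $A$-module map $\tau_\triangleright:\hat A_R\to M_R$, $\tau_\triangleright(a\rightharpoonup\hat1)=a\triangleright1_M$ ($a\in A$), is also a unital $*$-algebra homomorphism.
   Context: A finite dimensional weak $C^*$-Hopf algebra is a finite dimensional $C^*$-algebra $A$ (unit $1$) with linear maps $\Delta:A\to A\otimes A$, $\varepsilon:A\to\mathbb C$, $S:A\to A$ such that, for all $x,y,z\in A$ in Sweedler notation: $\Delta(xy)=\Delta(x)\Delta(y)$; $\Delta(x^* )=\Delta(x)^*$; $(\Delta\otimes\mathrm{id})\Delta=(\mathrm{id}\otimes\Delta)\Delta$; $(\Delta(1)\otimes1)(1\otimes\Delta(1))=1_{(1)}\otimes1_{(2)}\otimes1_{(3)}$; $(\varepsilon\otimes\mathrm{id})\Delta=\mathrm{id}=(\mathrm{id}\otimes\varepsilon)\Delta$; $\varepsilon(xyz)=\varepsilon(xy_{(1)})\varepsilon(y_{(2)}z)$; $S(x_{(1)})x_{(2)}=1_{(1)}\varepsilon(x1_{(2)})$; $x_{(1)}S(x_{(2)})=\varepsilon(1_{(1)}x)1_{(2)}$; $S(x_{(1)})x_{(2)}S(x_{(3)})=S(x)$. ($\Delta(1)\neq 1\otimes 1$ in general; $S$ is automatically invertible.) Put $x_*:=S(x)^*$. The dual $\hat A$ is the dual vector space with $\langle\psi\varphi|x\rangle=\langle\psi\otimes\varphi|\Delta(x)\rangle$,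 $\langle\hat\Delta(\psi)|x\otimes y\rangle=\langle\psi|xy\rangle$, $\hat1=\varepsilon$, $\hat\varepsilon(\psi)=\langle\psi|1\rangle$, $\langle\hat S(\psi)|x\rangle=\langle\psi|S(x)\rangle$, $\langle\psi^*|x\rangle=\overline{\langle\psi|x_*\rangle}$; it is again a finite dimensional weak $C^*$-Hopf algebra. $\hat A$ is an $A$-module algebra under $\langle a\rightharpoonup\varphi|b\rangle=\langle\varphi|ba\rangle$, and $\hat A_R:=A\rightharpoonup\hat1\subset\hat A$. An $A$-module algebra is a unital $*$-algebra $M$ with a linear left action $\triangleright:A\otimes M\to M$ with $(ab)\triangleright m=a\triangleright(b\triangleright m)$, $1\triangleright m=m$, $a\triangleright(mn)=(a_{(1)}\triangleright m)(a_{(2)}\triangleright n)$, $(a\triangleright m)^*=a_*\triangleright m^*$, $a\triangleright1_M=(a_{(1)}S(a_{(2)}))\triangleright1_M$. The map $\tau_\triangleright$ is a well defined surjective $A$-module map. *)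

(* Defs.v *)
From HB Require Import structures.
From mathcomp Require Import all_boot all_order all_algebra.
From mathcomp Require Import all_classical all_reals.
From mathcomp Require Import falgebra complex.

Set Implicit Arguments.
Unset Strict Implicit.
Unset Printing Implicit Defensive.

Import GRing.Theory Num.Theory.

Local Open Scope ring_scope.
Local Open Scope classical_set_scope.

(* The matrix t stands for the tensor \sum_(i, j) t i j *: (e_i (x) f_j), where
   (e_i) and (f_j) are the bases vbasis {:V} of V and vbasis {:W} of W. *)
Definition tensor (K : fieldType) (V W : vectType K) : vectType K :=
  'M[K]_(\dim {:V}, \dim {:W}).

Definition tens (K : fieldType) (V W : vectType K) (v : V) (w : W) :
    tensor V W :=
  \matrix_(i, j) (coord (vbasis {:V}) i v * coord (vbasis {:W}) j w).

Notation "v *t w" := (tens v w) (at level 40, left associativity) : ring_scope.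

(* The linear map on V (x) W induced by a bilinear f: see tlift_tens below. *)
Definition tlift (K : fieldType) (V W : vectType K) (U : lmodType K)
    (f : V -> W -> U) (t : tensor V W) : U :=
  \sum_i \sum_j t i j *: f (vbasis {:V})`_i (vbasis {:W})`_j.

Definition tmul (K : fieldType) (V W : vectType K)
    (mulV : V -> V -> V) (mulW : W -> W -> W) (s t : tensor V W) :
    tensor V W :=
  tlift (fun a b => tlift (fun c d => mulV a c *t mulW b d) t) s.

(* The antilinear map v (x) w |-> v^* (x) w^*. *)
Definition tstar (C : numClosedFieldType) (V W : vectType C)
    (starV : V -> V) (starW : W -> W) (t : tensor V W) : tensor V W :=
  tlift (fun a b => starV a *t starW b) (map_mx Num.conj t).

Lemma tlift_tens (K : fieldType) (V W : vectType K) (U : lmodType K)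
    (f : V -> W -> U) (v : V) (w : W) :
  (forall y, linear (f^~ y)) -> (forall x, linear (f x)) ->
  tlift f (v *t w) = f v w.
Proof.
move=> fl fr.
pose fl' y := GRing.isLinear.Build _ _ _ _ (f^~ y) (fl y).
pose fr' x := GRing.isLinear.Build _ _ _ _ (f x) (fr x).
pose Fl y : {linear V -> U} := HB.pack (f^~ y) (fl' y).
pose Fr x : {linear W -> U} := HB.pack (f x) (fr' x).
have El x y : f x y = Fl y x by [].
have Er x y : f x y = Fr x y by [].
rewrite [in RHS](coord_vbasis (memvf v)) El linear_sum.
apply: eq_bigr => i _; rewrite linearZ_LR -El Er.
rewrite [in RHS](coord_vbasis (memvf w)) linear_sum scaler_sumr.
by apply: eq_bigr => j _; rewrite linearZ_LR scalerA mxE.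
Qed.

Lemma tlift_linear (K : fieldType) (V W : vectType K) (U : lmodType K)
    (f : V -> W -> U) : linear (tlift f).
Proof.
move=> k s t; rewrite /tlift scaler_sumr -big_split; apply: eq_bigr => i _ /=.
rewrite scaler_sumr -big_split; apply: eq_bigr => j _ /=.
by rewrite !mxE scalerDl scalerA.
Qed.

(* Algebras of the library are unital and satisfy 1 != 0. *)
HB.mixin Record isStarAlgebra (C : numClosedFieldType) (A : Type)
    of GRing.Algebra C A := {
  star : A -> A;
  starK : involutive star;
  starD : forall x y : A, star (x + y) = star x + star y;
  starZ : forall (k : C) (x : A), star (k *: x) = k^* *: star x;
  starM : forall x y : A, star (x * y) = star y * star x;
}.

#[short(type="starAlgType")]
HB.structure Definition StarAlgebra (C : numClosedFieldType) :=
  { A of GRing.Algebra C A & isStarAlgebra C A }.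

(* As for the norms of the library over a numDomainType, the values of cnorm are
   nonnegative reals of C. When C is the field of complex numbers, completeness
   is automatic in finite dimension. *)
HB.mixin Record isCStarAlgebra (C : numClosedFieldType) (A : Type)
    of StarAlgebra C A := {
  cnorm : A -> C;
  cnorm_ge0 : forall x : A, 0 <= cnorm x;
  cnorm0_eq0 : forall x : A, cnorm x = 0 -> x = 0;
  cnormD : forall x y : A, cnorm (x + y) <= cnorm x + cnorm y;
  cnormZ : forall (k : C) (x : A), cnorm (k *: x) = `|k| * cnorm x;
  cnormM : forall x y : A, cnorm (x * y) <= cnorm x * cnorm y;
  cnorm_star : forall x : A, cnorm (star x * x) = cnorm x ^+ 2;
}.

#[short(type="finCStarAlgType")]
HB.structure Definition FinCStarAlgebra (C : numClosedFieldType) :=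
  { A of StarAlgebra C A & isCStarAlgebra C A & Falgebra C A }.

(* Sweedler notation: for E bilinear in a and b, \sw_(a, b <- t) E is the sum
   of the E over any decomposition of t into elementary tensors a (x) b. *)
Reserved Notation "\sw_ ( a , b <- t ) E"
  (at level 41, E at level 41, a name, b name, t at level 50,
   format "'[' \sw_ ( a ,  b  <-  t ) '/  '  E ']'").
Notation "\sw_ ( a , b <- t ) E" := (tlift (fun a b => E) t) : ring_scope.

HB.mixin Record isWeakCStarHopfAlgebra (C : numClosedFieldType) (A : Type)
    of FinCStarAlgebra C A := {
  comult : 'Hom(A, tensor A A);
  counit : 'Hom(A, C^o);
  antipode : 'End(A);
  comultM : forall x y : A,
    comult (x * y) = tmul *%R *%R (comult x) (comult y);
  comult_star : forall x : A,
    comult (star x) = tstar (@star C A) (@star C A) (comult x);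
  comultA : forall x : A,
    \sw_(a, b <- comult x) \sw_(a1, a2 <- comult a) (a1 *t (a2 *t b)) =
    \sw_(a, b <- comult x) (a *t comult b);
  comult_unit :
    tmul *%R (tmul *%R *%R)
      (\sw_(a, b <- comult 1) (a *t (b *t (1 : A)))) ((1 : A) *t comult 1) =
    \sw_(a, b <- comult 1) (a *t comult b);
  counitl : forall x : A, \sw_(a, b <- comult x) (counit a *: b) = x;
  counitr : forall x : A, \sw_(a, b <- comult x) (counit b *: a) = x;
  counitM : forall x y z : A,
    counit (x * y * z) =
    \sw_(y1, y2 <- comult y) (counit (x * y1) * counit (y2 * z));
  antipodel : forall x : A,
    \sw_(a, b <- comult x) (antipode a * b) =
    \sw_(a, b <- comult 1) (counit (x * b) *: a);
  antipoder : forall x : A,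
    \sw_(a, b <- comult x) (a * antipode b) =
    \sw_(a, b <- comult 1) (counit (a * x) *: b);
  antipodeK : forall x : A,
    \sw_(a, b <- comult x) \sw_(b1, b2 <- comult b)
      (antipode a * b1 * antipode b2) = antipode x;
}.

#[short(type="weakCStarHopfAlgType")]
HB.structure Definition WeakCStarHopfAlgebra (C : numClosedFieldType) :=
  { A of FinCStarAlgebra C A & isWeakCStarHopfAlgebra C A }.

(* Usually written x_*, with the star as a subscript. *)
Definition lowstar (C : numClosedFieldType) (A : weakCStarHopfAlgType C)
    (x : A) : A :=
  star (antipode x).

Definition dual (C : numClosedFieldType) (A : weakCStarHopfAlgType C) :
    vectType C :=
  'Hom(A, C^o).

Section Dual.
Variables (C : numClosedFieldType) (A : weakCStarHopfAlgType C).
Implicit Types (phi psi : dual A) (a x : A).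

Definition dual_one : dual A := counit.

Definition dual_mul psi phi : dual A :=
  linfun (fun x : A => \sw_(x1, x2 <- comult x) (psi x1 * phi x2)).

Definition dual_star psi : dual A :=
  linfun (fun x : A => (psi (lowstar x))^* : C^o).

(* a acts on phi by the left harpoon action. *)
Definition dual_act a phi : dual A :=
  linfun (fun x : A => phi (x * a)).

(* linfun f is only meaningful when f is linear: these three lemmas show that it
   is so in the definitions above. *)
Lemma dual_mulE psi phi x :
  dual_mul psi phi x = \sw_(x1, x2 <- comult x) (psi x1 * phi x2).
Proof.
pose f (x : A) : C^o := \sw_(x1, x2 <- comult x) (psi x1 * phi x2).
have fl : linear f by move=> k y z; rewrite /f linearP tlift_linear.
pose fl' := GRing.isLinear.Build _ _ _ _ f fl.
pose F : {linear A -> C^o} := HB.pack f fl'.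
exact: (lfunE F x).
Qed.

Lemma dual_starE psi x : dual_star psi x = (psi (lowstar x))^*.
Proof.
pose f (x : A) : C^o := (psi (lowstar x))^*.
have fl : linear f.
  move=> k y z; rewrite /f /lowstar linearP starD starZ linearP /=.
  by rewrite rmorphD rmorphM /= conjCK.
pose fl' := GRing.isLinear.Build _ _ _ _ f fl.
pose F : {linear A -> C^o} := HB.pack f fl'.
exact: (lfunE F x).
Qed.

Lemma dual_actE a phi x : dual_act a phi x = phi (x * a).
Proof.
pose f (x : A) : C^o := phi (x * a).
have fl : linear f.
  by move=> k y z; rewrite /f mulrDl -scalerAl linearP.
pose fl' := GRing.isLinear.Build _ _ _ _ f fl.
pose F : {linear A -> C^o} := HB.pack f fl'.
exact: (lfunE F x).
Qed.

Definition dual_R : set (dual A) := range (dual_act^~ dual_one).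

End Dual.

Arguments dual_R {C} A.

HB.mixin Record isModuleAlgebra (C : numClosedFieldType)
    (A : weakCStarHopfAlgType C) (M : Type) of StarAlgebra C M := {
  act : A -> M -> M;
  act_linearl : forall m : M, linear (act^~ m);
  act_linearr : forall a : A, linear (act a);
  actA : forall (a b : A) (m : M), act (a * b) m = act a (act b m);
  act1 : forall m : M, act 1 m = m;
  act_mul : forall (a : A) (m n : M),
    act a (m * n) = \sw_(a1, a2 <- comult a) (act a1 m * act a2 n);
  act_star : forall (a : A) (m : M),
    star (act a m) = act (lowstar a) (star m);
  act_unit : forall a : A,
    act a 1 = act (\sw_(a1, a2 <- comult a) (a1 * antipode a2)) 1;
}.

#[short(type="moduleAlgType")]
HB.structure Definition ModuleAlgebra (C : numClosedFieldType)
    (A : weakCStarHopfAlgType C) :=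
  { M of StarAlgebra C M & isModuleAlgebra C A M }.

Definition module_R (C : numClosedFieldType) (A : weakCStarHopfAlgType C)
    (M : moduleAlgType A) : set M :=
  range (fun a : A => act a (1 : M)).

Arguments module_R {C A} M.

(* The operations are explicit arguments so that these notions apply to the dual
   without first establishing that it is a star algebra. *)
Record unital_star_subalgebra (C : numClosedFieldType) (V : lmodType C)
    (mul : V -> V -> V) (one : V) (star : V -> V) (B : set V) : Prop := {
  subalg_one : B one;
  subalg_linear : forall (k : C) (u v : V), B u -> B v -> B (k *: u + v);
  subalg_mul : forall u v : V, B u -> B v -> B (mul u v);
  subalg_star : forall u : V, B u -> B (star u);
}.

Record unital_star_hom_on (C : numClosedFieldType) (V W : lmodType C)
    (mulV : V -> V -> V) (oneV : V) (starV : V -> V)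
    (mulW : W -> W -> W) (oneW : W) (starW : W -> W)
    (B : set V) (f : V -> W) : Prop := {
  hom_one : f oneV = oneW;
  hom_linear : forall (k : C) (u v : V), B u -> B v ->
    f (k *: u + v) = k *: f u + f v;
  hom_mul : forall u v : V, B u -> B v -> f (mulV u v) = mulW (f u) (f v);
  hom_star : forall u : V, B u -> f (starV u) = starW (f u);
}.

(* Main.v *)
Require Import Defs.
From HB Require Import structures.
From mathcomp Require Import all_boot all_order all_algebra.
From mathcomp Require Import all_classical all_reals.
From mathcomp Require Import complex.

Set Implicit Arguments.
Unset Strict Implicit.
Unset Printing Implicit Defensive.

Local Open Scope ring_scope.
Local Open Scope classical_set_scope.

Import GRing.Theory Num.Theory.

(* Put PiL a = eps(1_(1) a) 1_(2) and PiR a = 1_(1) eps(a 1_(2)).  Then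
   Delta(PiL a) = 1_(1) PiL a (x) 1_(2), which gives both
     (a |> 1)(b |> 1) = (PiL a * b) |> 1  in M  and
     (a -> eps)(b -> eps) = (PiL a * b) -> eps  in the dual,
   where -> is the left harpoon action.  The star on the dual sends a -> eps to
   a_* -> eps, since eps(y S(x)) = eps(y PiR x) and eps(S(x) y) = eps(PiL x y).
   Finally phi |-> phi(1_(1)) 1_(2) |> 1 is a linear map on the whole dual which
   sends a -> eps to PiL a |> 1 = a |> 1, so tau is its restriction. *)

(** * Bilinear maps and Sweedler sums *)

Section Tensor.
Variable K : fieldType.
Implicit Types V W : vectType K.
Implicit Types U X : lmodType K.

Definition bilin V W U (f : V -> W -> U) : Prop :=
  (forall y, linear (f^~ y)) /\ (forall x, linear (f x)).

Lemma eq_tlift V W U (f g : V -> W -> U) (t : tensor V W) :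
  (forall a b, f a b = g a b) -> tlift f t = tlift g t.
Proof.
by move=> e; apply: eq_bigr => i _; apply: eq_bigr => j _; rewrite e.
Qed.

Lemma linear_scale U X (g : U -> X) k u : linear g -> g (k *: u) = k *: g u.
Proof.
(* This instance of linearity yields g 0 = 0. *)
move=> gl; have gB := gl (-1) 0 0.
rewrite scaler0 addr0 scaleN1r addNr in gB.
by have := gl k u 0; rewrite gB !addr0.
Qed.

Lemma linear_sum_fun U X (g : U -> X) n (F : 'I_n -> U) :
  linear g -> g (\sum_i F i) = \sum_i g (F i).
Proof.
move=> gl; pose gl' := GRing.isLinear.Build _ _ _ _ g gl.
pose G : {linear U -> X} := HB.pack g gl'.
exact: (linear_sum G).
Qed.

Lemma linear_tlift V W U X (g : U -> X) (f : V -> W -> U) (t : tensor V W) :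
  linear g -> g (tlift f t) = tlift (fun a b => g (f a b)) t.
Proof.
move=> gl; rewrite linear_sum_fun //; apply: eq_bigr => i _.
by rewrite linear_sum_fun //; apply: eq_bigr => j _; rewrite linear_scale.
Qed.

Lemma linear_tliftf V W U X (F : X -> V -> W -> U) (t : tensor V W) :
  (forall a b, linear (fun x => F x a b)) -> linear (fun x => tlift (F x) t).
Proof.
move=> Fl k x y; rewrite /tlift scaler_sumr -big_split.
apply: eq_bigr => i _ /=.
rewrite scaler_sumr -big_split; apply: eq_bigr => j _ /=.
by rewrite Fl scalerDr !scalerA mulrC.
Qed.

Lemma tlift_tlift V W V' W' U (f : V -> W -> U)
    (h : V' -> W' -> tensor V W) (t : tensor V' W') :
  tlift f (tlift h t) = \sw_(a, b <- t) tlift f (h a b).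
Proof. exact: (linear_tlift h t (tlift_linear f)). Qed.

Lemma bilin_tens V W : bilin (@tens K V W).
Proof.
split=> [y|x] k u v; apply/matrixP=> i j; rewrite !mxE linearP /=.
  by rewrite mulrDl mulrA.
by rewrite mulrDr mulrCA.
Qed.

Lemma linear_mulr (B : algType K) (w : B) : linear (fun v : B => v * w).
Proof. by move=> k u v; rewrite mulrDl scalerAl. Qed.

Lemma linear_mull (B : algType K) (w : B) : linear (fun v : B => w * v).
Proof. by move=> k u v; rewrite mulrDr scalerAr. Qed.

Lemma bilin_mul V W (B : algType K) (f : V -> B) (g : W -> B) :
  linear f -> linear g -> bilin (fun v w => f v * g w).
Proof.
move=> fl gl; split=> [w|v] k s t; first by rewrite fl mulrDl scalerAl.
by rewrite gl mulrDr scalerAr.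
Qed.

Lemma bilin_scale V W U (f : V -> K^o) (g : W -> U) :
  linear f -> linear g -> bilin (fun v w => f v *: g w).
Proof.
move=> fl gl; split=> [w|v] k s t; first by rewrite fl scalerDl scalerA.
by rewrite gl scalerDr !scalerA mulrC.
Qed.

Lemma tlift_bilin V W U (f : V -> W -> U) v w :
  bilin f -> tlift f (v *t w) = f v w.
Proof. by case; apply: tlift_tens. Qed.

Lemma tlift_tmul V W U mulV mulW (f : V -> W -> U) (s t : tensor V W) :
  bilin f ->
  tlift f (tmul mulV mulW s t) =
  \sw_(a, b <- s) \sw_(c, d <- t) f (mulV a c) (mulW b d).
Proof.
move=> fl; rewrite tlift_tlift; apply: eq_tlift => a b.
by rewrite tlift_tlift; apply: eq_tlift => c d; rewrite tlift_bilin.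
Qed.

End Tensor.

(** * Antilinear maps and the star on tensors *)

Section Antilinear.
Variable C : numClosedFieldType.
Implicit Types V W : vectType C.
Implicit Types U X : lmodType C.

Definition antilinear U X (g : U -> X) : Prop :=
  forall k x y, g (k *: x + y) = k^* *: g x + g y.

Lemma antilinear_sum U X (g : U -> X) n (F : 'I_n -> U) :
  antilinear g -> g (\sum_i F i) = \sum_i g (F i).
Proof.
move=> gl.
have gD x y : g (x + y) = g x + g y by rewrite -[x]scale1r gl conjC1 !scale1r.
apply: (big_morph g gD).
by apply: (@addrI _ (g 0)); rewrite -gD !addr0.
Qed.

Lemma antilinear_scale U X (g : U -> X) k u :
  antilinear g -> g (k *: u) = k^* *: g u.
Proof.
move=> gl; have g0 := antilinear_sum (fun=> 0) gl (n := 0).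
by rewrite !big_ord0 in g0; rewrite -[k *: u]addr0 gl g0 addr0.
Qed.

Lemma antilinear_star (B : starAlgType C) : antilinear (@star C B).
Proof. by move=> k u v; rewrite starD starZ. Qed.

Lemma antilinear_conj : antilinear (fun x : C^o => x^* : C^o).
Proof. by move=> k u v; rewrite rmorphD rmorphM. Qed.

(** [tstar] conjugates the same coefficients as g does. With [tstar_comult1] this moves a star or a
    conjugation through a sum over Delta(1). *)
Lemma antilinear_tlift V W U X (g : U -> X) (f : V -> W -> U)
    (f' : V -> W -> X) (sV : V -> V) (sW : W -> W) (t : tensor V W) :
  antilinear g -> bilin f' ->
  (forall a b, g (f a b) = f' (sV a) (sW b)) ->
  g (tlift f t) = tlift f' (tstar sV sW t).
Proof.
move=> gl fl e; rewrite tlift_tlift antilinear_sum //.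
apply: eq_bigr => i _; rewrite antilinear_sum //; apply: eq_bigr => j _.
by rewrite antilinear_scale // e tlift_bilin // mxE.
Qed.

Lemma tstar_tens V W (sV : V -> V) (sW : W -> W) v w :
  antilinear sV -> antilinear sW -> tstar sV sW (v *t w) = sV v *t sW w.
Proof.
move=> sVl sWl.
rewrite [in RHS](coord_vbasis (memvf v)) [in RHS](coord_vbasis (memvf w)).
rewrite (antilinear_sum _ sVl) (antilinear_sum _ sWl).
rewrite (linear_sum_fun _ ((bilin_tens _ _).1 _)).
apply: eq_bigr => i _; rewrite (antilinear_scale _ _ sVl).
rewrite (linear_scale _ _ ((bilin_tens _ _).1 _)).
rewrite (linear_sum_fun _ ((bilin_tens _ _).2 _)) scaler_sumr.
apply: eq_bigr => j _; rewrite (antilinear_scale _ _ sWl).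
rewrite (linear_scale _ _ ((bilin_tens _ _).2 _)).
by rewrite scalerA !mxE rmorphM.
Qed.

Lemma star1 (B : starAlgType C) : star 1 = 1 :> B.
Proof. by rewrite -[LHS]mulr1 -{2}[1](starK) -starM mulr1 starK. Qed.

End Antilinear.

(** * Counital maps, and the antipode under the counit *)

Section Counit.
Variables (C : numClosedFieldType) (A : weakCStarHopfAlgType C).
Implicit Types a b x y z : A.

Lemma tstar_comult1 : tstar (@star C A) (@star C A) (comult 1) = comult 1.
Proof. by rewrite -comult_star star1. Qed.

(** Uniqueness of the counit: [eps'] is again a left counit for Delta, and applying a left and a
    right counit to the two legs of Delta(y) shows that they agree at y. *)
Lemma counit_star x : counit (star x) = (counit x)^*.
Proof.
pose eps' x : C^o := (counit (star x))^*.
have eps'l : linear eps'.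
  move=> k y z; rewrite /eps' antilinear_star linearP /=.
  by rewrite rmorphD rmorphM /= conjCK.
suff e y : counit y = eps' y by rewrite e /eps' starK.
have eps'E : \sw_(a, b <- comult y) (eps' a *: b) = y.
  have := congr1 star (counitl (star y)); rewrite starK => {2}<-.
  rewrite (@antilinear_tlift _ _ _ _ _ _ _ (fun a b => eps' a *: b) star star).
  - by rewrite -comult_star starK.
  - exact: antilinear_star.
  - by apply: bilin_scale; [exact: eps'l|move=> k u v].
  - by move=> a b; rewrite starZ /eps' starK.
rewrite -{1}eps'E (linear_tlift _ _ (linearP counit)).
rewrite -{2}[y]counitr (linear_tlift _ _ eps'l).
apply: eq_tlift => a b; rewrite linearZ /=.
rewrite (linear_scale _ _ eps'l); exact: mulrC.
Qed.

Local Notation mA := (@GRing.mul A).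

Lemma linear_counitM y : linear (fun x => counit (y * x) : C^o).
Proof. by move=> k u v; rewrite mulrDr -scalerAr linearP. Qed.

Lemma linear_counitMr y : linear (fun x => counit (x * y) : C^o).
Proof. by move=> k u v; rewrite mulrDl -scalerAl linearP. Qed.

(** By [antipoder] this is x_(1) S(x_(2)); likewise [PiR x] below is S(x_(1)) x_(2) by
    [antipodel]. *)
Definition PiL x : A :=
  \sw_(a, b <- comult 1) (counit ((a : A) * x) *: (b : A)).

Definition PiR x : A :=
  \sw_(a, b <- comult 1) (counit (x * (b : A)) *: (a : A)).

(** The conjugate of [PiL] under the star, see [star_PiL]; its coproduct can be read off from
    [comult_unit]. *)
Definition PL x : A :=
  \sw_(a, b <- comult 1) (counit (x * (a : A)) *: (b : A)).

Lemma counitM1 x z :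
  counit (x * z) = \sw_(a, b <- comult 1)
    (counit (x * (a : A)) * counit ((b : A) * z)).
Proof. by rewrite -counitM mulr1. Qed.

(** [counitM1] has the legs of Delta(1) in the other order. Conjugating its instance for star z and
    star x exchanges them, since Delta(1) is self-adjoint. *)
Lemma counitM1_swap x z :
  counit (x * z) =
  \sw_(a, b <- comult 1) (counit ((a : A) * z) * counit (x * (b : A))) :> C^o.
Proof.
have -> : counit (x * z) = (counit (star z * star x))^*.
  by rewrite -starM counit_star conjCK.
rewrite counitM1 -[in RHS]tstar_comult1.
apply: (antilinear_tlift _ (@antilinear_conj C)).
- exact: (bilin_mul (B := C^o) (linear_counitMr z) (linear_counitM x)).
by move=> a b; rewrite rmorphM /= -!counit_star !starM !starK.
Qed.

Lemma counit_PiL x z : counit (x * PiL z) = counit (x * z).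
Proof.
rewrite [RHS]counitM1_swap (linear_tlift _ _ (linear_counitM x)).
by apply: eq_tlift => a b; rewrite -scalerAr linearZ.
Qed.

Lemma counit_PiR x z : counit (PiR x * z) = counit (x * z).
Proof.
rewrite [RHS]counitM1_swap (linear_tlift _ _ (linear_counitMr z)).
by apply: eq_tlift => a b; rewrite -scalerAl linearZ /= mulrC.
Qed.

(* Both sides equal eps(y S(x_(1)) x_(2) S(x_(3))), as x_(2) may be replaced by
   PiL x_(2) = x_(2) S(x_(3)) at the right end of the counit. *)
Lemma counit_antipoder y x : counit (y * antipode x) = counit (y * PiR x).
Proof.
rewrite -antipodeK /PiR -antipodel !(linear_tlift _ _ (linear_counitM y)).
apply: eq_tlift => a b.
rewrite mulrA -[RHS]counit_PiL /PiL -antipoder.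
rewrite !(linear_tlift _ _ (linear_counitM _)).
by apply: eq_tlift => c d; rewrite !mulrA.
Qed.

(** S(x) = PiR(x_(1)) S(x_(2)), and the counit absorbs [PiR] at its left end by [counit_PiR], which
    leaves x_(1) S(x_(2)) = PiL x. *)
Lemma counit_antipodel y x : counit (antipode x * y) = counit (PiL x * y).
Proof.
have -> : antipode x = \sw_(a, b <- comult x) (PiR a * antipode b).
  rewrite -antipodeK.
  (* [F] and [G] turn [comultA] into the rebracketing of S(x_(1)) x_(2) S(x_(3)) that groups the
     first two factors into PiR(x_(1)). *)
  pose F a b c := antipode a * b * antipode c.
  pose G (a : A) (t : tensor A A) := tlift (F a) t.
  have Gl : bilin G.
    split=> [t|a]; last exact: tlift_linear.
    by apply: linear_tliftf => b c k u v; rewrite /F linearP !mulrDl -!scalerAl.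
  have Fl a : bilin (F a).
    by apply: bilin_mul; [exact: linear_mull|exact: linearP].
  have := congr1 (tlift G) (comultA x).
  rewrite !tlift_tlift => e.
  transitivity (\sw_(a, b <- comult x) tlift G (a *t comult b)).
    by apply: eq_tlift => a b; rewrite tlift_bilin.
  rewrite -e; apply: eq_tlift => a b; rewrite tlift_tlift /PiR -antipodel.
  rewrite (linear_tlift _ _ (linear_mulr (antipode b))).
  by apply: eq_tlift => c d; rewrite tlift_bilin // /G tlift_bilin.
rewrite /PiL -antipoder !(linear_tlift _ _ (linear_counitMr y)).
by apply: eq_tlift => a b; rewrite -!mulrA counit_PiR.
Qed.

(** The left side is eps(star a PiR x) and the right side is the conjugate of eps(PiL a star x).
    Expanded over Delta(1), the two match because Delta(1) is self-adjoint. *)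
Lemma counit_antipode_star a x :
  (counit (star (antipode x) * a))^* = counit (x * star (antipode a)).
Proof.
have -> : (counit (star (antipode x) * a))^* = counit (star a * PiR x).
  by rewrite -counit_star starM starK counit_antipoder.
have -> : counit (x * star (antipode a)) = (counit (PiL a * star x))^*.
  by rewrite -counit_antipodel -counit_star starM starK.
have -> : counit (star a * PiR x) =
    \sw_(b, c <- comult 1)
      (counit (star a * (b : A)) * counit (x * (c : A))) :> C^o.
  rewrite (linear_tlift _ _ (linear_counitM _)); apply: eq_tlift => b c.
  by rewrite -scalerAr linearZ /= mulrC.
have -> : counit (PiL a * star x) =
    \sw_(b, c <- comult 1)
      (counit ((b : A) * a) * counit ((c : A) * star x)) :> C^o.
  rewrite (linear_tlift _ _ (linear_counitMr _)); apply: eq_tlift => b c.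
  by rewrite -scalerAl linearZ.
rewrite -[in LHS]tstar_comult1; apply/esym.
apply: (antilinear_tlift _ (@antilinear_conj C)).
- exact: (bilin_mul (B := C^o) (linear_counitM _) (linear_counitM _)).
by move=> b c; rewrite rmorphM /= -!counit_star !starM starK.
Qed.

(** * Coproducts of counital elements and the operations on the dual *)

Lemma star_PiL x : star (PiL x) = PL (star x).
Proof.
rewrite /PL -tstar_comult1; apply: antilinear_tlift.
- exact: antilinear_star.
- by apply: bilin_scale; [exact: linear_counitM|move=> k u v].
by move=> a b; rewrite starZ -counit_star starM.
Qed.

(* Obtained from [comult_unit] by applying eps(x -) to the first tensor factor. *)
Lemma comult_PL x : comult (PL x) = \sw_(a, b <- comult 1) (PL x * a *t b).
Proof.
pose G (a : A) (t : tensor A A) : tensor A A := counit (x * a) *: t.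
have Gl : bilin G by apply: bilin_scale; [exact: linear_counitM|move=> k u v].
have := congr1 (tlift G) (comult_unit (s := A)).
rewrite tlift_tmul // [RHS]tlift_tlift tlift_tlift => e.
transitivity (\sw_(a, b <- comult 1) tlift G (a *t comult b)).
  rewrite (linear_tlift _ _ (linearP comult)); apply: eq_tlift => a b.
  by rewrite tlift_bilin // linearZ.
rewrite -e.
have tmulr (s : tensor A A) : linear (tmul mA mA s).
  by apply: linear_tliftf => a b; exact: tlift_linear.
have mult (t : tensor A A) :
    bilin (fun a b : A => \sw_(c, d <- t) ((a * c) *t (b * d))).
  split=> [b|a]; apply: linear_tliftf => c d k u v.
    by rewrite linear_mulr (bilin_tens _ _).1.
  by rewrite linear_mulr (bilin_tens _ _).2.
have tmull (t : tensor A A) : linear (fun s => tmul mA mA s t).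
  exact: tlift_linear.
pose g b : tensor A A := \sw_(c, d <- comult 1) ((b * c) *t d).
have gl : linear g.
  by apply: linear_tliftf => c d k u v; rewrite linear_mulr (bilin_tens _ _).1.
rewrite -[RHS]/(g (PL x)) (linear_tlift _ _ gl).
apply: eq_tlift => a b.
(* [H a t] is the result of multiplying a (x) t by 1 (x) Delta(1) and then applying eps(x -) to the
   first factor. *)
pose H a t : tensor A A := G a (tmul mA mA t (comult 1)).
have Hl : bilin H.
  by apply: bilin_scale; [exact: linear_counitM|exact: tmull].
have HE a0 t : \sw_(c, d <- (1 : A) *t comult 1)
    G (a0 * c) (tmul mA mA t d) = H a0 t.
  rewrite tlift_bilin /H; first by rewrite mulr1.
  apply: bilin_scale; last exact: tmulr.
  by move=> k u v; rewrite linear_mull linear_counitM.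
rewrite (eq_tlift _ HE) tlift_bilin // /H /G /tmul tlift_bilin //.
rewrite (linear_scale _ _ gl); congr (_ *: _); apply: eq_tlift => c d.
by rewrite mul1r.
Qed.

(** The star of [comult_PL], which turns left multiplication by [PL] into right multiplication by
    [PiL]. *)
Lemma comult_PiL x :
  comult (PiL x) = \sw_(a, b <- comult 1) (((a : A) * PiL x) *t (b : A)).
Proof.
rewrite -[PiL x]starK star_PiL comult_star comult_PL -[in RHS]tstar_comult1.
apply: antilinear_tlift.
- move=> k s t; rewrite /tstar -tlift_linear; congr tlift.
  by apply/matrixP=> i j; rewrite !mxE rmorphD rmorphM.
- split=> [b|a] k u v; last by rewrite (bilin_tens _ _).2.
  by rewrite linear_mulr (bilin_tens _ _).1.
by move=> a b; rewrite tstar_tens ?starM //; exact: antilinear_star.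
Qed.

(** Delta(x) Delta(PiL y) = Delta(x) Delta(1) (PiL y (x) 1), and Delta(x) absorbs Delta(1). A
    general f serves both the product of the dual and that of M. *)
Lemma tlift_comultM_PiL (U : lmodType C) (f : A -> A -> U) x y :
  bilin f ->
  tlift f (comult (x * PiL y)) = \sw_(a, b <- comult x) f ((a : A) * PiL y) b.
Proof.
move=> fl; pose f' a b := f ((a : A) * PiL y) b.
have f'l : bilin f'.
  by split=> [b|a] k u v; rewrite /f' ?linear_mulr ?fl.1 ?fl.2.
rewrite comultM tlift_tmul // -/f' -[x in RHS]mulr1 comultM tlift_tmul //.
apply: eq_tlift => a b; rewrite comult_PiL tlift_tlift.
apply: eq_tlift => c d; rewrite tlift_bilin /f' ?mulrA //.
by split=> [v|u] k s t; rewrite linear_mull ?fl.1 ?fl.2.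
Qed.

(** At x the product is eps(x_(1) a) eps(x_(2) b). Replacing a by PiL a makes this a sum over
    Delta(x PiL a), which the counit axiom collapses to eps(x PiL a b). *)
Lemma dual_mul_act a b :
  dual_mul (dual_act a (dual_one A)) (dual_act b (dual_one A)) =
  dual_act (PiL a * b) (dual_one A).
Proof.
apply/lfunP=> x; rewrite dual_mulE dual_actE /dual_one.
pose f (u v : A) : C^o := counit u * counit (v * b).
have fl : bilin f.
  by apply: (bilin_mul (B := C^o)); [exact: linearP|exact: linear_counitMr].
rewrite mulrA -[x * PiL a in RHS]counitl.
rewrite (linear_tlift _ _ (linear_counitMr b)).
transitivity (tlift f (comult (x * PiL a))).
  rewrite tlift_comultM_PiL //; apply: eq_tlift => u v.
  by rewrite !dual_actE /f counit_PiL.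
by apply: eq_tlift => u v; rewrite -scalerAl linearZ.
Qed.

Lemma dual_act1 (phi : dual A) : dual_act 1 phi = phi.
Proof. by apply/lfunP=> x; rewrite dual_actE mulr1. Qed.

Lemma dual_actA a b (phi : dual A) :
  dual_act a (dual_act b phi) = dual_act (a * b) phi.
Proof. by apply/lfunP=> x; rewrite !dual_actE mulrA. Qed.

Lemma dual_act_linear (phi : dual A) : linear (fun a => dual_act a phi).
Proof.
move=> k a b; apply/lfunP=> x; rewrite !lfunE /= !lfunE /= !dual_actE.
by rewrite linear_mull linearP.
Qed.

Lemma dual_star_act a :
  dual_star (dual_act a (dual_one A)) = dual_act (lowstar a) (dual_one A).
Proof.
apply/lfunP=> x; rewrite dual_starE !dual_actE; exact: counit_antipode_star.
Qed.

End Counit.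

(** * The orbit of the unit of M and the map tau *)

Section Module.
Variables (C : numClosedFieldType) (A : weakCStarHopfAlgType C).
Variable M : moduleAlgType A.
Implicit Types (a b : A) (m : M).

Lemma act_PiL a : act a (1 : M) = act (PiL a) 1.
Proof. by rewrite act_unit antipoder. Qed.

(** Write the left side as 1 acting on the product, replace a by PiL a, and recognise the action of
    1 PiL a on 1 m. *)
Lemma act1_mul a m : act a 1 * m = act (PiL a) m.
Proof.
have fl : bilin (fun b c => act b (1 : M) * act c m).
  by apply: bilin_mul; exact: act_linearl.
rewrite -[m in RHS]mul1r act_mul -[PiL a in RHS]mul1r tlift_comultM_PiL //.
rewrite -[LHS](act1 (s := M)) act_mul; apply: eq_tlift => b c.
by rewrite actA -act_PiL.
Qed.

(** This formula depends on phi alone, so no representative a of a -> eps has to be chosen. *)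
Definition dual_to_module (phi : dual A) : M :=
  \sw_(a, b <- comult 1) (phi (a : A) *: act (b : A) 1).

Lemma dual_to_module_act a :
  dual_to_module (dual_act a (dual_one A)) = act a 1.
Proof.
rewrite act_PiL (linear_tlift _ _ (act_linearl _)).
apply: eq_tlift => b c; rewrite dual_actE.
by rewrite (linear_scale _ _ (act_linearl _)).
Qed.

Lemma dual_to_module_linear : linear dual_to_module.
Proof.
apply: linear_tliftf => a b k phi psi.
by rewrite lfunE /= lfunE /= scalerDl scalerA.
Qed.

End Module.

Theorem proposition2p2p2 (R : realType) (A : weakCStarHopfAlgType R[i])
    (M : moduleAlgType A) :
  unital_star_subalgebra (V := M) *%R 1 star (module_R M) /\
  unital_star_subalgebra (@dual_mul _ A) (dual_one A) (@dual_star _ A)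
    (dual_R A) /\
  exists tau : dual A -> M,
    [/\ forall a : A, tau (dual_act a (dual_one A)) = act a 1,
        set_fun (dual_R A) (module_R M) tau,
        set_surj (dual_R A) (module_R M) tau,
        forall (a : A) (phi : dual A), dual_R A phi ->
          tau (dual_act a phi) = act a (tau phi) &
        unital_star_hom_on (V := dual A) (W := M)
          (@dual_mul _ A) (dual_one A) (@dual_star _ A) *%R 1 star
          (dual_R A) tau].
Proof.
split.
  split.
  - by exists 1 => //; rewrite act1.
  - move=> k _ _ [a _ <-] [b _ <-]; exists (k *: a + b) => //.
    exact: act_linearl.
  - move=> _ _ [a _ <-] [b _ <-]; exists (PiL a * b) => //.
    by rewrite act1_mul actA.
  by move=> _ [a _ <-]; exists (lowstar a) => //; rewrite act_star star1.
split.
  split.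
  - by exists 1 => //; rewrite dual_act1.
  - move=> k _ _ [a _ <-] [b _ <-]; exists (k *: a + b) => //.
    exact: dual_act_linear.
  - move=> _ _ [a _ <-] [b _ <-]; exists (PiL a * b) => //.
    by rewrite dual_mul_act.
  by move=> _ [a _ <-]; exists (lowstar a) => //; rewrite dual_star_act.
exists (@dual_to_module _ _ M); split.
- exact: dual_to_module_act.
- by move=> _ [a _ <-]; exists a => //; rewrite dual_to_module_act.
- move=> _ [a _ <-]; exists (dual_act a (dual_one A)); first by exists a.
  exact: dual_to_module_act.
- by move=> a _ [b _ <-]; rewrite dual_actA !dual_to_module_act actA.
split.
(* The unit eps of the dual is 1 -> eps, hence is sent to 1 |> 1. *)
- by rewrite -[dual_one A]dual_act1 dual_to_module_act act1.
- by move=> k u v _ _; exact: dual_to_module_linear.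
- move=> _ _ [a _ <-] [b _ <-].
  by rewrite dual_mul_act !dual_to_module_act act1_mul actA.
by move=> _ [a _ <-]; rewrite dual_star_act !dual_to_module_act act_star star1.
Qed.
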